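(* Let $G=(G_*,d_i,s_i)$ be a simplicial group and let $n\ge 2$. Let $D_n$ be the subgroup of $G_n$ generated by the degenerate elements. If $G_n=D_n$, then $$d_n(\mathbf{N}_nG)\subseteq\prod_{I\cup J=[n-1]}\Big[\bigcap_{i\in I}\ker d_i,\ \bigcap_{j\in J}\ker d_j\Big],$$ where $I,J$ range over the nonempty subsets of $[n-1]$ with $I\cup J=[n-1]$, and the kernels are those of the faces $d_i:G_{n-1}\to G_{n-2}$.
   Context: $[n-1]=\{0,1,\dots,n-1\}$. The Moore complex is $\mathbf{N}_nG=\bigcap_{i=0}^{n-1}\ker(d_i:G_n\to G_{n-1})$, with differential $d$ induced by the last face $d_n$. The degenerate elements of $G_n$ are the elements $s_i(x)$ with $x\in G_{n-1}$, $0\le i\le n-1$. Square brackets $[H,K]$ denote the commutator subgroup generated by all $[h,k]$, $h\in H$, $k\in K$. The product over $(I,J)$ denotes the product of (equivalently, the subgroup of $G_{n-1}$ generated by) the indicated normal subgroups of $G_{n-1}$. *)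

(* Defs.v *)
From mathcomp Require Import all_boot.
From mathcomp Require Import boolp classical_sets.

Set Implicit Arguments.
Unset Strict Implicit.
Unset Printing Implicit Defensive.

Local Open Scope classical_set_scope.

Definition subgroup (G : groupType) (H : set G) : Prop :=
  group_closed (mem H).

Definition generated (G : groupType) (A : set G) : set G :=
  smallest (@subgroup G) A.

(* MathComp's commutator is [~ h, k] = h^-1 k^-1 h k.  For subgroups H and K,
   the other convention h k h^-1 k^-1 generates the same subgroup. *)
Definition commutator (G : groupType) (H K : set G) : set G :=
  generated [set [~ h, k]%g | h in H & k in K].

Definition kernel (G H : groupType) (f : G -> H) : set G :=
  [set x | f x = 1%g].

(* [face n i] is d_i : G_(n+1) -> G_n with 0 <= i <= n+1, and [degen n i] is
   s_i : G_n -> G_(n+1) with 0 <= i <= n.  In the simplicial identities every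
   argument of [inord] lies in the range of the target ordinal type. *)
Record simplicialGroup := SimplicialGroup {
  level :> nat -> groupType;
  face n : 'I_n.+2 -> UMagmaMorphism.type (level n.+1) (level n);
  degen n : 'I_n.+1 -> UMagmaMorphism.type (level n) (level n.+1);
  face_face n i j (x : level n.+2) : (i < j <= n.+2)%N ->
    face (inord i) (face (inord j) x) = face (inord j.-1) (face (inord i) x);
  degen_degen n i j (x : level n) : (i <= j <= n)%N ->
    degen (inord i) (degen (inord j) x) =
    degen (inord j.+1) (degen (inord i) x);
  face_degen_lt n i j (x : level n.+1) : (i < j <= n.+1)%N ->
    face (inord i) (degen (inord j) x) = degen (inord j.-1) (face (inord i) x);
  face_degen_id n j (x : level n) : (j <= n)%N ->
    face (inord j) (degen (inord j) x) = x;
  face_degen_succ n j (x : level n) : (j <= n)%N ->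
    face (inord j.+1) (degen (inord j) x) = x;
  face_degen_gt n i j (x : level n.+1) : (j.+1 < i <= n.+2)%N ->
    face (inord i) (degen (inord j) x) = degen (inord j) (face (inord i.-1) x)
}.

Definition moore (G : simplicialGroup) (n : nat) : set (G n) :=
  match n return set (G n) with
  | 0 => setT
  | m.+1 => \bigcap_(i in [set i : 'I_m.+2 | (i < m.+1)%N]) kernel (face G i)
  end.

Arguments moore : clear implicits.

Definition degenerate (G : simplicialGroup) (n : nat) : set (G n) :=
  match n return set (G n) with
  | 0 => set0
  | m.+1 => [set degen G i x | i in [set: 'I_m.+1] & x in [set: G m]]
  end.

Arguments degenerate : clear implicits.

(* For n = p + 1, 'I_p.+1 is [n-1], which indexes the faces of G_(n-1) = G_p.
   I and J need not be disjoint. *)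
Definition covering_pairs (p : nat) : set (set 'I_p.+1 * set 'I_p.+1) :=
  [set IJ | [/\ IJ.1 !=set0, IJ.2 !=set0 & IJ.1 `|` IJ.2 = [set: 'I_p.+1]]].

Arguments covering_pairs : clear implicits.

(* The product of the normal subgroups [/\_(i in I) ker d_i, /\_(j in J) ker d_j]
   of G_(m+1), taken as the subgroup they generate. *)
Definition face_commutators (G : simplicialGroup) (m : nat) : set (G m.+1) :=
  generated (\bigcup_(IJ in covering_pairs m.+1)
    commutator (\bigcap_(i in IJ.1) kernel (face G i))
               (\bigcap_(j in IJ.2) kernel (face G j))).

Arguments face_commutators : clear implicits.

(* Main.v *)
(** Write [K_I] for the intersection of the kernels of the [d_i], [i] in [I],
    write [K_<k] for [K_{0,...,k-1}], and let [P] be the right-hand side of the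
    theorem.  Put [M_n = {x in K_<n | d_n x in P}] and, for [k < n],
    [M_k = s_k (K_<k) M_(k+1)].  Descending induction shows, for [k >= 1], that
    [M_k] is a normal subgroup of [G_n] which contains [[K_I, K_J]] whenever
    [I] and [J] are nonempty and cover [{0,...,k-1}]: splitting [x = s_k d_k x x']
    and [y = s_k d_k y y'] with [x'] and [y'] in [ker d_k], the commutator
    [[x, y]] agrees modulo [M_(k+1)] with [s_k d_k [x, y]].  Consequently
    [M_0 = s_0 (G_(n-1)) M_1] is a subgroup; it contains all degenerate elements,
    so it is [G_n].  Applying [d_0, d_1, ...] successively to an element of [N_n G]
    strips its degenerate factors and puts it in [M_n]. *)
Require Import Defs.
From mathcomp Require Import all_boot.
From mathcomp Require Import boolp classical_sets.

Local Open Scope classical_set_scope.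

(** * Subgroups, normality and commutators *)

Definition normal_subgroup {G : groupType} (H : set G) : Prop :=
  subgroup H /\ forall x g : G, H x -> H (x ^ g)%g.

Section Subgroups.
Context {G : groupType}.
Implicit Types (H A : set G) (x y z g : G).
Local Open Scope group_scope.

Lemma subgroupP H :
  subgroup H <-> H 1 /\ forall x y, H x -> H y -> H (x * y^-1).
Proof.
split=> [[H1 HB]|[H1 HB]]; split.
- by move: H1; rewrite in_setE.
- by move=> x y Hx Hy; have := HB x y; rewrite !in_setE; apply.
- by rewrite in_setE.
- by move=> x y; rewrite !in_setE; apply: HB.
Qed.

Lemma subgroup1 H : subgroup H -> H 1.
Proof. by case/subgroupP. Qed.

Lemma subgroupV H x : subgroup H -> H x -> H x^-1.
Proof. by case/subgroupP => H1 HB Hx; rewrite -[x^-1]mul1g; apply: HB. Qed.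

Lemma subgroupM H x y : subgroup H -> H x -> H y -> H (x * y).
Proof.
move=> sH Hx Hy; rewrite -[y]invgK.
by case/subgroupP: (sH) => _; apply => //; apply: subgroupV.
Qed.

Lemma generated_subgroup A : subgroup (generated A).
Proof.
apply/subgroupP; split=> [H [sH _]|x y gx gy H HA]; first exact: subgroup1.
by case/subgroupP: HA.1 => _; apply; [apply: gx|apply: gy].
Qed.

Lemma conj_preimage_subgroup H :
  subgroup H -> subgroup [set x | forall g, H (x ^ g)].
Proof.
move=> sH; apply/subgroupP; split=> [g|x y Hx Hy g] /=.
  by rewrite conj1g; apply: subgroup1.
by rewrite conjMg conjVg; apply: subgroupM => //; apply: subgroupV.
Qed.

Lemma generated_normal A :
  (forall x g, A x -> generated A (x ^ g)) -> normal_subgroup (generated A).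
Proof.
move=> nA; split=> [|x g gx]; first exact: generated_subgroup.
apply: (gx [set x | forall g, generated A (x ^ g)]).
split; first exact/conj_preimage_subgroup/generated_subgroup.
by move=> y Ay h; apply: nA.
Qed.

Lemma commutator_normal H K :
  normal_subgroup H -> normal_subgroup K -> normal_subgroup (commutator H K).
Proof.
move=> [_ nH] [_ nK]; apply: generated_normal => _ g [h Hh [k Kk <-]].
apply: sub_gen_smallest; exists (h ^ g); first exact: nH.
by exists (k ^ g); [apply: nK|rewrite conjRg].
Qed.

End Subgroups.

(** * Kernels of faces and the retractions [s_k d_k] *)

Section SimplicialGroup.
Variable G : simplicialGroup.
Local Open Scope group_scope.

Local Notation d i := (face G (inord i)).
Local Notation s i := (degen G (inord i)).

(* Only used with the elements of [I] at most [p.+1], where [inord] is faithful. *)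
Definition face_kernel p (I : set nat) : set (G p.+1) :=
  [set x | forall i, I i -> d i x = 1].

Local Notation below k := [set i | (i < k)%N].

Lemma face_kernel_normal p I : normal_subgroup (face_kernel p I).
Proof.
split=> [|x g Kx i Ii]; last by rewrite gmulfJ Kx ?conj1g.
apply/subgroupP; split=> [i _|x y Kx Ky i Ii]; first exact: gmulf1.
by rewrite gmulfM gmulfV Kx // Ky // invg1 mulg1.
Qed.

Lemma face_kernel_retract p k I (x : G p.+2) :
  (k <= p.+1)%N -> I `<=` below k -> face_kernel p.+1 I x ->
  face_kernel p.+1 I (s k (d k x)).
Proof.
move=> kp Ik Kx i Ii; have ik : (i < k)%N := Ik i Ii.
rewrite face_degen_lt ?ik // face_face ?ik ?(leq_trans kp) //.
by rewrite Kx // !gmulf1.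
Qed.

(** The factor [x'] of the splitting [x = s_k d_k x * x'], hence the component of [x] in the kernel
    of [d_k]. *)
Definition reduce {p} k (x : G p.+1) : G p.+1 := (s k (d k x))^-1 * x.

Lemma reduce_kernel p k I (x : G p.+2) :
  (k <= p.+1)%N -> I `<=` below k -> face_kernel p.+1 I x ->
  face_kernel p.+1 (k |` I) (reduce k x).
Proof.
move=> kp Ik Kx i [->|Ii]; rewrite /reduce.
  by rewrite gmulfM gmulfV face_degen_id ?mulVg.
have Ks := @face_kernel_retract p k I x kp Ik Kx i Ii.
by rewrite gmulfM gmulfV (Kx i Ii) Ks invg1 mulg1.
Qed.

Lemma below_succ k : below k.+1 = k |` below k.
Proof.
apply/seteqP; split=> i /=; rewrite ltnS [(i <= k)%N]leq_eqVlt.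
  by case/orP => [/eqP|]; [left|right].
by case=> [->|->]; rewrite ?eqxx ?orbT.
Qed.

Lemma face_commutators_normal m : normal_subgroup (face_commutators G m).
Proof.
apply: generated_normal => x g [[I J] cIJ /= cx].
apply: sub_gen_smallest; exists (I, J) => //=.
have nK (L : set 'I_m.+2) : normal_subgroup (\bigcap_(i in L) kernel (face G i)).
  split=> [|y h Ky i Li].
    apply/subgroupP; split=> [i _|y z Ky Kz i Li]; rewrite /kernel /=.
      exact: gmulf1.
    by rewrite gmulfM gmulfV (Ky i) // (Kz i) // invg1 mulg1.
  by rewrite /kernel /= gmulfJ (Ky i) ?conj1g.
by case: (commutator_normal _ _ (nK I) (nK J)) => _; apply.
Qed.

(** * The subgroups [M_k], with [n = m + 2] *)

Variable m : nat.

(* [reducible k r], used with [k + r = n], is the subgroup called [M_k] above: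
   [x] lies in [s_k (K_<k) M_(k+1)] iff it lies in [K_<k] and
   [(s_k d_k x)^-1 x] lies in [M_(k+1)]. *)
Fixpoint reducible k r (x : G m.+2) : Prop :=
  face_kernel m.+1 (below k) x /\
  if r is r'.+1 then reducible k.+1 r' (reduce k x)
  else face_commutators G m (d k x).

Lemma reducible_kernel k r x : reducible k r x -> face_kernel m.+1 (below k) x.
Proof. by case: r => [|r] []. Qed.

Definition absorbs_commutators k (M : set (G m.+2)) : Prop :=
  forall I J x y, I !=set0 -> J !=set0 -> I `|` J = below k ->
  face_kernel m.+1 I x -> face_kernel m.+1 J y -> M [~ x, y].

Lemma commg_kernel I J (x y : G m.+2) :
  face_kernel m.+1 I x -> face_kernel m.+1 J y ->
  face_kernel m.+1 (I `|` J) [~ x, y].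
Proof.
move=> Kx Ky i [Ii|Ji]; rewrite gmulfR; first by rewrite Kx ?comm1g.
by rewrite (Ky i) ?commg1.
Qed.

Lemma reducible_top_normal : normal_subgroup (reducible m.+2 0).
Proof.
have [sK nK] := face_kernel_normal m.+1 (below m.+2).
have [sP nP] := face_commutators_normal m.
split=> [|x g [Kx Px]]; last by split; [apply: nK|rewrite gmulfJ; apply: nP].
apply/subgroupP; split=> [|x y [Kx Px] [Ky Py]].
  by split; [apply: (subgroup1 _ sK)|rewrite gmulf1; apply: (subgroup1 _ sP)].
split; first by apply: (subgroupM _ _ _ sK) => //; apply: (subgroupV _ _ sK).
by rewrite gmulfM gmulfV; apply: (subgroupM _ _ _ sP) => //; apply: (subgroupV _ _ sP).
Qed.

(** For [i < n], the identity [d_i d_n = d_(n-1) d_i] carries the vanishing of [d_i] on [x] over to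
    [d_n x]. *)
Lemma last_face_kernel I (x : G m.+2) :
  I `<=` below m.+2 -> face_kernel m.+1 I x ->
  (\bigcap_(i in [set i : 'I_m.+2 | I i]) kernel (face G i)) (d m.+2 x).
Proof.
move=> In Kx i Ii; rewrite /kernel /= -[i]inord_val.
by rewrite face_face ?ltn_ord ?leqnn // Kx // gmulf1.
Qed.

Lemma reducible_top_commutators : absorbs_commutators m.+2 (reducible m.+2 0).
Proof.
move=> I J x y [i Ii] [j Jj] IJ Kx Ky.
have [In Jn] : I `<=` below m.+2 /\ J `<=` below m.+2.
  by rewrite -IJ; split=> l; [left|right].
split; first by rewrite -IJ; apply: commg_kernel.
rewrite gmulfR; apply: sub_gen_smallest.
exists ([set i : 'I_m.+2 | I i], [set j : 'I_m.+2 | J j]).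
  split=> /=.
  - by exists (Ordinal (In i Ii)).
  - by exists (Ordinal (Jn j Jj)).
  - apply/seteqP; split=> // l _.
    by have : (I `|` J) l by rewrite IJ; apply: ltn_ord.
apply: sub_gen_smallest; exists (d m.+2 x); first exact: last_face_kernel.
by exists (d m.+2 y) => //; apply: last_face_kernel.
Qed.

(** Kept apart from the normality step so as to cover [k = 0], where [M_0] is only shown to be a
    subgroup. *)
Lemma reducible_subgroup_step k r :
  normal_subgroup (reducible k.+1 r) -> subgroup (reducible k r.+1).
Proof.
move=> [sM nM]; have [sK _] := face_kernel_normal m.+1 (below k).
apply/subgroupP; split=> [|x y [Kx Mx] [Ky My]]; split.
- exact: (subgroup1 _ sK).
- by rewrite /reduce !gmulf1 invg1 mulg1; apply: (subgroup1 _ sM).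
- by apply: (subgroupM _ _ _ sK) => //; apply: (subgroupV _ _ sK).
(* [reduce k] is multiplicative up to conjugation, which the normality of [M_(k+1)] absorbs. *)
have -> : reduce k (x * y^-1) = (reduce k x * (reduce k y)^-1) ^ (s k (d k y))^-1.
  by rewrite /reduce conjgE !gmulfM !gmulfV !invgM !invgK !mulgA mulgK.
by apply: (nM); apply: subgroupM => //; apply: subgroupV.
Qed.

Lemma reducible_normal_step k r : (0 < k)%N -> (k <= m.+1)%N ->
  normal_subgroup (reducible k.+1 r) ->
  absorbs_commutators k.+1 (reducible k.+1 r) ->
  normal_subgroup (reducible k r.+1).
Proof.
move=> k0 kn nsM cM; split; first exact: reducible_subgroup_step.
move=> x g [Kx Mx]; have [sM nM] := nsM.
have [_ nK] := face_kernel_normal m.+1 (below k).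
split; first exact: nK.
(* With [g'] for [reduce k g], the factor [s_k d_k x] of [x] is conjugated by [g] to [X ^ g'], and
   [X] is [s_k d_k (x ^ g)]. So the error term is [[~ X, g']], absorbed through the cover of
   [{0,...,k}] by [{0,...,k-1}] and [{k}]; the first set is nonempty as [0 < k]. *)
pose X := s k (d k x) ^ s k (d k g).
have -> : reduce k (x ^ g) = [~ X, reduce k g] * reduce k x ^ g.
  rewrite /X /reduce commgEl -conjgM mulVKg 2!gmulfJ.
  by rewrite conjMg conjVg -[RHS]mulgA mulVKg.
apply: subgroupM (nM _ _ Mx) => //; apply: (cM (below k) [set k]).
- by exists 0%N.
- by exists k.
- by rewrite below_succ setUC.
- rewrite /X -!gmulfJ; apply: face_kernel_retract => //; exact: nK.
- by move=> i ->; apply: (@reduce_kernel m k set0) => //; left.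
Qed.

Lemma reducible_commutators_step k r : (k <= m.+1)%N ->
  normal_subgroup (reducible k.+1 r) ->
  absorbs_commutators k.+1 (reducible k.+1 r) ->
  absorbs_commutators k (reducible k r.+1).
Proof.
move=> kn [sM nM] cM I J x y I0 J0 IJ Kx Ky.
have [Ik Jk] : I `<=` below k /\ J `<=` below k.
  by rewrite -IJ; split=> l; [left|right].
have Kxy : face_kernel m.+1 (below k) [~ x, y].
  by rewrite -IJ; apply: commg_kernel.
split=> //.
set x' := reduce k x; set y' := reduce k y.
set X := s k (d k x); set W := s k (d k [~ x, y]).
have Kx' : face_kernel m.+1 (k |` I) x' by apply: reduce_kernel.
have Ky' : face_kernel m.+1 (k |` J) y' by apply: reduce_kernel.
(* Expand [[~ x, y]] along both splittings; [W] is [[~ X, s_k d_k y]]. Each resulting commutator has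
   an entry in the kernel of [d_k], so adding [k] to [J], splitting off [{k}], or adding [k] to [I]
   gives a cover of [{0,...,k}]. *)
have -> : reduce k [~ x, y] =
    ([~ X, y'] ^ x') ^ W * [~ W, y' * x'] * [~ x', y].
  have xE : x = X * x' by rewrite mulVKg.
  have yE : y = s k (d k y) * y' by rewrite mulVKg.
  have WE : W = [~ X, s k (d k y)] by rewrite /W !gmulfR.
  have commMg a b c : [~ a * b, c] = [~ a, c] ^ b * [~ b, c] :> G m.+2.
    by rewrite /commg /conjg !gnorm.
  have commgM a b c : [~ a, b * c] = [~ a, c] * [~ a, b] ^ c :> G m.+2.
    by rewrite /commg /conjg !gnorm.
  rewrite /reduce -/W {1}xE commMg {1}yE commgM -WE conjMg.
  rewrite [([~ X, y'] ^ x') ^ W]conjgE commgEl -conjgM.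
  by rewrite !mulgA mulgK.
apply: subgroupM => //; first apply: subgroupM => //.
- apply: (nM); apply: (nM); apply: (cM I (k |` J)) => //.
  + by exists k; left.
  + by rewrite below_succ -IJ setUCA.
  + exact: face_kernel_retract.
- apply: (cM (below k) [set k]).
  + by case: I0 => i /Ik ik; exists i.
  + by exists k.
  + by rewrite below_succ setUC.
  + exact: face_kernel_retract.
  + by move=> _ ->; rewrite gmulfM Kx' ?Ky' ?mulg1 //; left.
- apply: (cM (k |` I) J) => //.
  + by exists k; left.
  + by rewrite below_succ -IJ setUA.
Qed.

Lemma reducible_normal k r : (0 < k)%N -> (k + r = m.+2)%N ->
  normal_subgroup (reducible k r) /\ absorbs_commutators k (reducible k r).
Proof.
elim: r k => [|r IH] k k0.
  rewrite addn0 => ->.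
  by split; [apply: reducible_top_normal|apply: reducible_top_commutators].
rewrite addnS => kr; have kn : (k <= m.+1)%N by case: kr => <-; apply: leq_addr.
have [nM cM] := IH k.+1 isT kr.
by split; [apply: reducible_normal_step|apply: reducible_commutators_step].
Qed.

(** For [k < j] the simplicial identities make [reduce k] commute with [s_j], so the element stays
    in the image of [s_j]; at [k = j] it reduces to 1. As [j <= m + 1], this happens before the top
    stage. *)
Lemma reducible_degen j r k (a : G m.+1) : (k <= j <= m.+1)%N ->
  (k + r = m.+2)%N -> face_kernel m.+1 (below k) (s j a) ->
  reducible k r (s j a).
Proof.
elim: r k a => [|r IH] k a /andP[kj jm].
  by rewrite addn0 => kE; move: (leq_trans kj jm); rewrite kE ltnn.
rewrite addnS => kr Ka; split=> //.
move: kj; rewrite leq_eqVlt => /orP[/eqP kj|kj].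
  subst k; rewrite /reduce face_degen_id // mulVg.
  have [[sM _] _] := reducible_normal j.+1 r isT kr.
  exact: (subgroup1 _ sM).
have km : (k <= m.+1)%N by apply: leq_trans jm; apply: ltnW.
have redE : reduce k (s j a) = s j (reduce k a).
  rewrite /reduce gmulfM gmulfV face_degen_lt ?kj //.
  rewrite degen_degen ?(ltn_predK kj) //.
  by rewrite -ltnS (ltn_predK kj) kj -ltnS (ltn_predK kj).
rewrite redE; apply: IH => //; first by rewrite kj.
by rewrite -redE below_succ; apply: reduce_kernel.
Qed.

(** Since [d_k x = 1] for [k < n], each [reduce k] fixes [x], which thus reaches [M_n] unchanged. *)
Lemma reducible_moore k r x : (k + r = m.+2)%N ->
  face_kernel m.+1 (below m.+2) x -> reducible k r x ->
  face_commutators G m (d m.+2 x).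
Proof.
elim: r k => [|r IH] k; first by rewrite addn0 => -> _ [].
rewrite addnS => kr Kx [_]; rewrite /reduce Kx /=; last first.
  by rewrite -kr ltnS leq_addr.
by rewrite gmulf1 invg1 mul1g; apply: IH.
Qed.

End SimplicialGroup.

(* n = m + 2 *)
Theorem lemma21 (G : simplicialGroup) (m : nat)
  (hD : generated (degenerate G m.+2) = [set: G m.+2]) :
  face G (@ord_max m.+2) @` moore G m.+2 `<=` face_commutators G m.
Proof.
move=> _ [x Nx <-].
have -> : @ord_max m.+2 = inord m.+2 by apply/val_inj; rewrite /= inordK.
apply: (@reducible_moore G m 0 m.+2) => //.
  by move=> i /= im; apply: Nx; rewrite /= inordK // ltnW.
(* It remains to see that [M_0] is a subgroup containing the degenerate elements. *)
have : generated (degenerate G m.+2) x by rewrite hD.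
apply; split.
  by apply: reducible_subgroup_step; have [] := reducible_normal G m 1 m.+1.
move=> _ [j _ [a _ <-]]; rewrite -[j]inord_val.
by apply: reducible_degen => //; apply: (ltn_ord j).
Qed.
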